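(* Let $(X,d)$ be a compact metric space and let $(X,\mathbb{F})$ be the non-autonomous dynamical system generated by a commutative family $\mathbb{F}=\{f_n:n\in\mathbb{N}\}$ of homeomorphisms of $X$. If $x\in X$ is almost periodic, then every point in $\mathcal{O}_H(x)$ is almost periodic. Further, if $(X,\mathbb{F})$ is equicontinuous (and $x$ is almost periodic), then every point in $\overline{\mathcal{O}_H(x)}$ is almost periodic.
   Context: $\mathbb{N}=\{1,2,3,\dots\}$. The family $\mathbb{F}$ is commutative if $f_n\circ f_m=f_m\circ f_n$ for all $n,m$. The non-autonomous system $(X,\mathbb{F})$ has time-$n$ states $\omega_n(x)$, $n\in\mathbb{Z}$, defined by $\omega_0(x)=x$, $\omega_n(x)=f_n(\omega_{n-1}(x))$ for $n\ge 1$, and $\omega_n(x)=f_{-n}^{-1}(\omega_{n+1}(x))$ for $n<0$; thus $\omega_n=f_n\circ\cdots\circ f_1$ and $\omega_{-n}=f_n^{-1}\circ\cdots\circ f_1^{-1}$ for $n\geq 1$. The orbital hull of $x$ is $\mathcal{O}_H(x)=\{(\omega_{k_n}\circ\omega_{k_{n-1}}\circ\cdots\circ\omega_{k_1})(x): k_i\in\mathbb{Z},\ n\in\mathbb{N}\}$. A subset of $\mathbb{Z}$ is syndetic if for some $M\in\mathbb{N}$ it meets every set of $M$ consecutive integers. A point $x$ is almost periodic if for every $\epsilon>0$ the set $\{n\in\mathbb{Z}: d(\omega_n(x),x)<\epsilon\}$ is syndetic. $(X,\mathbb{F})$ is equicontinuous if for each $\epsilon>0$ there exists $\delta>0$ such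 that for all $x,y\in X$, $d(x,y)<\delta$ implies $d(\omega_n(x),\omega_n(y))<\epsilon$ for all $n\in\mathbb{Z}$. *)

(* Defs.v *)
From HB Require Import structures.
From mathcomp Require Import all_boot all_order all_algebra.
From mathcomp Require Import all_classical all_reals topology.

Set Implicit Arguments.
Unset Strict Implicit.
Unset Printing Implicit Defensive.

Import Order.TTheory GRing.Theory Num.Theory.

Local Open Scope classical_set_scope.
Local Open Scope ring_scope.

Record homeo (X : topologicalType) := Homeo {
  homeo_fun :> X -> X ;
  homeo_inv : X -> X ;
  homeo_funK : cancel homeo_fun homeo_inv ;
  homeo_invK : cancel homeo_inv homeo_fun ;
  homeo_fun_continuous : continuous homeo_fun ;
  homeo_inv_continuous : continuous homeo_inv }.

(* A family (f_n) indexed by n = 1, 2, 3, ... is encoded as F : nat -> homeo X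
   with F i standing for f_(i+1). *)
Section nonautonomous_topological.
Context {X : topologicalType}.
Implicit Types (F : nat -> homeo X) (x : X).

Definition commutative_family F : Prop :=
  forall n m, F n \o F m = F m \o F n.

Fixpoint forward_state F (n : nat) x : X :=
  if n is k.+1 then F k (forward_state F k x) else x.

Fixpoint backward_state F (n : nat) x : X :=
  if n is k.+1 then homeo_inv (F k) (backward_state F k x) else x.

(* [Negz k] is the integer - (k + 1). *)
Definition omega F (n : int) x : X :=
  match n with
  | Posz k => forward_state F k x
  | Negz k => backward_state F k.+1 x
  end.

(* The head of the sequence is the index applied first. *)
Definition orbital_hull F x : set X :=
  [set y | exists2 ks : seq int,
     (0 < size ks)%N & y = foldl (fun z k => omega F k z) x ks].

End nonautonomous_topological.

Definition syndetic (A : set int) : Prop :=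
  exists2 M : nat, (0 < M)%N &
    forall a : int, exists2 i : nat, (i < M)%N & A (a + i%:Z).

Section nonautonomous_metric.
Context {R : realType} {X : metricType R}.
Implicit Types (F : nat -> homeo X) (x : X).

Definition almost_periodic F x : Prop :=
  forall eps : R, 0 < eps -> syndetic [set n | mdist (omega F n x) x < eps].

(* Uniform over X, unlike the pointwise [equicontinuous] of function_spaces. *)
Definition equicontinuous_system F : Prop :=
  forall eps : R, 0 < eps ->
    exists2 delta : R, 0 < delta &
      forall x y : X, mdist x y < delta ->
        forall n : int, mdist (omega F n x) (omega F n y) < eps.

End nonautonomous_metric.

(* Main.v *)
(* By commutativity every omega_k commutes with every omega_n, so a point y of
   the orbital hull is g(x) for a continuous g commuting with all time-n maps;
   then omega_n(y) = g(omega_n(x)) is close to g(x) = y whenever omega_n(x) is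
   close to x. Under equicontinuity almost periodicity is a closed condition, by
   comparing a limit point with a nearby almost periodic point. *)
Require Import Defs.
From mathcomp Require Import all_boot all_order all_algebra.
From mathcomp Require Import all_classical all_reals topology.
From mathcomp Require Import lra.

Import Order.TTheory GRing.Theory Num.Theory.

Local Open Scope classical_set_scope.

Section commuting_states.
Context {X : topologicalType}.
Implicit Types (F : nat -> homeo X) (g : X -> X).

(** Commuting with a bijection entails commuting with its inverse, as cancelling [F i] on both sides
    shows; induction on the number of factors then covers both signs of [n]. *)
Lemma omega_commute F g :
  (forall i z, g (F i z) = F i (g z)) ->
  forall n z, g (omega F n z) = omega F n (g z).
Proof.
move=> gF.
have gV i z : g (homeo_inv (F i) z) = homeo_inv (F i) (g z).
  by apply: (can_inj (homeo_funK (F i))); rewrite -gF !homeo_invK.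
have gB n z : g (backward_state F n z) = backward_state F n (g z).
  by elim: n => //= n IHn; rewrite gV IHn.
case=> n z; last exact: gB.
by elim: n => //= n IHn; rewrite gF IHn.
Qed.

(** Two uses of [omega_commute]: first with [g] a generator [F i], then with [g] the state map
    [omega F m], which by the first use commutes with every generator. *)
Lemma omega_omegaC F : commutative_family F ->
  forall m n z, omega F m (omega F n z) = omega F n (omega F m z).
Proof.
move=> FC m; apply: omega_commute => i z; apply/esym/omega_commute => j w.
by have /(congr1 (@^~ w)) := FC i j.
Qed.

Lemma omega_continuous F n : continuous (omega F n).
Proof.
have forward_continuous k : continuous (forward_state F k).
  elim: k => [|k IHk] z; first exact: cvg_id.
  apply: (@continuous_comp _ _ _ (forward_state F k) (F k)); first exact: IHk.
  exact: homeo_fun_continuous.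
have backward_continuous k : continuous (backward_state F k).
  elim: k => [|k IHk] z; first exact: cvg_id.
  apply: (@continuous_comp _ _ _ (backward_state F k) (homeo_inv (F k))).
    exact: IHk.
  exact: homeo_inv_continuous.
by case: n => k; [exact: forward_continuous | exact: backward_continuous].
Qed.

End commuting_states.

Lemma syndeticS (A B : set int) : A `<=` B -> syndetic A -> syndetic B.
Proof.
move=> AB [M M_gt0 AM]; exists M => // a.
by have [i iM Aai] := AM a; exists i => //; exact: AB.
Qed.

Section almost_periodic_points.
Context {R : realType} {X : metricType R}.
Implicit Types (F : nat -> homeo X) (x y : X).

Lemma almost_periodic_image F (g : X -> X) x :
  {for x, continuous g} ->
  (forall n, g (omega F n x) = omega F n (g x)) ->
  almost_periodic F x -> almost_periodic F (g x).
Proof.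
move=> gx gF apx eps eps0.
have /nbhs_ballP[d /= d0 gd] := gx _ (nbhsx_ballx (g x) _ eps0).
(* Return times of [x] to within [d] are return times of [g x] to within [eps]. *)
apply: syndeticS (apx d d0) => n /= nd.
move: (gd (omega F n x)); rewrite !ballEmdist /= -gF.
by rewrite (metric_sym x) (metric_sym (g x)); apply.
Qed.

Lemma almost_periodic_orbital_hull F x y :
  commutative_family F -> almost_periodic F x ->
  orbital_hull F x y -> almost_periodic F y.
Proof.
(* The base point varies in the induction: the head [k] acts first, so the remaining word starts
   from [omega F k x], again almost periodic. *)
move=> FC apx [ks _ ->]; elim: ks x apx => //= k ks IHks x apx.
apply/IHks/almost_periodic_image => //; first exact: omega_continuous.
by move=> n; exact: omega_omegaC.
Qed.

Lemma almost_periodic_closure F (A : set X) : equicontinuous_system F ->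
  A `<=` almost_periodic F -> closure A `<=` almost_periodic F.
Proof.
move=> eqF apA y clAy eps eps0.
have eps30 : (0 < eps / 3)%R by lra.
have [d d0 dF] := eqF _ eps30.
(* The bound [d] keeps the orbits of [y] and [z] within [eps / 3] at all times; the bound [eps / 3]
   controls the distance from [z] back to [y]. Hence each [eps / 3]-return time of [z] is an
   [eps]-return time of [y]. *)
have r0 : (0 < Num.min d (eps / 3))%R by rewrite lt_min d0.
have [z [Az]] := clAy _ (nbhsx_ballx y _ r0).
rewrite ballEmdist /= lt_min => /andP[yzd yze].
apply: syndeticS (apA z Az _ eps30) => n /= nz.
have yzn := dF _ _ yzd n.
have := metric_triangle (omega F n y) (omega F n z) y.
have := metric_triangle (omega F n z) z y.
rewrite (metric_sym z y); lra.
Qed.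

End almost_periodic_points.

Theorem proposition6 (R : realType) (X : metricType R) (F : nat -> homeo X)
    (x : X) (cptX : compact [set: X]) (commF : commutative_family F)
    (apx : almost_periodic F x) :
  (forall y : X, orbital_hull F x y -> almost_periodic F y) /\
  (equicontinuous_system F ->
     forall y : X, closure (orbital_hull F x) y -> almost_periodic F y).
Proof.
have hull_ap y := almost_periodic_orbital_hull F x y commF apx.
by split=> // eqF; exact: almost_periodic_closure.
Qed.
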